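(* Let $\mathbf A\in\{-1,0,1\}^{n\times n}$ be positive semidefinite. Then for any $\epsilon\in(0,1)$, there exists a deterministic algorithm which reads $O\!\left(\frac{n\log n}{\epsilon}\right)$ entries of $\mathbf A$ and returns a positive semidefinite $\widetilde{\mathbf A}\in\{-1,0,1\}^{n\times n}$ such that $\|\mathbf A-\widetilde{\mathbf A}\|_2\le\epsilon n$.
   Context: $\|\cdot\|_2$ is the spectral norm. *)

(* Defs.v *)
From HB Require Import structures.
From mathcomp Require Import all_boot all_order all_algebra.
From mathcomp Require Import all_classical all_reals all_analysis.
Set Implicit Arguments. Unset Strict Implicit. Unset Printing Implicit Defensive.
Import Order.TTheory GRing.Theory Num.Theory.
Local Open Scope classical_set_scope.
Local Open Scope ring_scope.

Definition ternary_mx (R : realType) (n : nat) (A : 'M[R]_n) : Prop :=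
  forall i j, A i j \in [:: -1; 0; 1].

Definition psd_mx (R : realType) (n : nat) (A : 'M[R]_n) : Prop :=
  A \is symmetricmx /\ forall x : 'cV[R]_n, 0 <= (x^T *m A *m x) 0 0.

(* The norm that the library puts on matrices is the largest absolute value of
   an entry, hence the Euclidean norm and its operator norm are defined here. *)
Definition l2norm (R : realType) (n : nat) (x : 'cV[R]_n) : R :=
  Num.sqrt (\sum_(i < n) x i 0 ^+ 2).

Definition spectral_norm (R : realType) (n : nat) (A : 'M[R]_n) : R :=
  sup [set l2norm (A *m x) | x in [set x : 'cV[R]_n | l2norm x <= 1]].

Lemma l2norm_ge_coord (R : realType) (n : nat) (x : 'cV[R]_n) (i : 'I_n) :
  `|x i 0| <= l2norm x.
Proof.
rewrite -sqrtr_sqr; apply: ler_wsqrtr.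
by rewrite (bigD1 i) //= lerDl sumr_ge0 // => j _; exact: sqr_ge0.
Qed.

(* [sup] returns 0 on sets without a supremum; this never happens in
   [spectral_norm]. *)
Lemma spectral_norm_has_sup (R : realType) (n : nat) (A : 'M[R]_n) :
  has_sup [set l2norm (A *m x) | x in [set x : 'cV[R]_n | l2norm x <= 1]].
Proof.
split.
  exists (l2norm (A *m 0)); exists 0 => //=.
  by rewrite /l2norm big1 ?sqrtr0 // => i _; rewrite mxE expr0n.
exists (Num.sqrt (\sum_(i < n) (\sum_(j < n) `|A i j|) ^+ 2)) => _ [x /= x1 <-].
apply/ler_wsqrtr/ler_sum => i _; rewrite -[leLHS]real_normK ?num_real //.
rewrite lerXn2r ?nnegrE // ?sumr_ge0 // mxE.
apply: (le_trans (ler_norm_sum _ _ _)); apply: ler_sum => j _.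
rewrite normrM ler_piMr //.
exact: le_trans (l2norm_ge_coord x j) x1.
Qed.

(* A deterministic adaptive algorithm with query access to the entries of an
   n x n matrix, as a decision tree: [Return B] halts with output B, and
   [Query i j k] reads the entry (i, j) and continues with k applied to the
   value that was read.  The tree has no other access to the input. *)
Inductive query_alg (R : Type) (n : nat) : Type :=
| Return of 'M[R]_n
| Query of 'I_n & 'I_n & (R -> query_alg R n).

Fixpoint run (R : Type) (n : nat) (alg : query_alg R n) (A : 'M[R]_n) :
    'M[R]_n :=
  match alg with
  | Return B => B
  | Query i j k => run (k (A i j)) A
  end.

(* Repeated reads of the same entry are counted each time. *)
Fixpoint num_reads (R : Type) (n : nat) (alg : query_alg R n) (A : 'M[R]_n) :
    nat :=
  match alg with
  | Return _ => 0%N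
  | Query i j k => (num_reads (k (A i j)) A).+1
  end.

(* Main.v *)
(* If A is psd with entries in {-1, 0, 1} and A i j <> 0, then row i is A i j
   times row j; hence, up to zero rows, A is block diagonal with rank-one blocks
   v v^T, v a sign vector, and one read decides whether two indices lie in the
   same block.  The Misra-Gries heavy-hitters scheme with k = floor(1/eps)
   counters, with this read as equality test, finds with n k reads at most k
   indices that meet every block of size more than n / (k + 1).  Reading their
   columns costs n k further reads and determines the blocks found.  The error
   consists of missed blocks, whose row sums are at most n / (k + 1) <= eps n in
   absolute value.  So O(n / eps) reads suffice, and the factor log n is only
   spent on the constant 2 / ln 2. *)
Require Import Defs.
From HB Require Import structures.
From mathcomp Require Import all_boot all_order all_algebra.
From mathcomp Require Import all_classical all_reals all_analysis.
From mathcomp Require Import ring lra zify.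
Set Implicit Arguments. Unset Strict Implicit. Unset Printing Implicit Defensive.
Import Order.TTheory GRing.Theory Num.Theory.
Local Open Scope ring_scope.

Lemma symmetricmxP (R : realType) n (A : 'M[R]_n) :
  reflect (forall i j, A i j = A j i) (A \is symmetricmx).
Proof.
apply: (iffP (is_hermitianmxP _ _ _)) => [AE i j | Asym].
  by rewrite {1}AE expr0 scale1r !mxE.
by apply/matrixP => i j; rewrite expr0 scale1r !mxE Asym.
Qed.

(** * Row structure of ternary positive semidefinite matrices *)

Section TernaryPSD.
Variables (R : realType) (n : nat) (A : 'M[R]_n).
Hypotheses (Atern : ternary_mx A) (Apsd : psd_mx A).

Lemma psd_sym i j : A i j = A j i.
Proof. by move: i j; apply/symmetricmxP; case: Apsd. Qed.

Lemma quad_delta (i j : 'I_n) :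
  ((delta_mx i 0 : 'cV[R]_n)^T *m A *m (delta_mx j 0 : 'cV[R]_n)) 0 0 = A i j.
Proof. by rewrite trmx_delta -rowE -colE !mxE. Qed.

Lemma ternary_norm_le1 i j : `|A i j| <= 1.
Proof.
have := Atern i j; rewrite !inE => /or3P[] /eqP->;
  by rewrite ?normrN ?normr1 ?normr0 ?ler01.
Qed.

(* If A i j <> 0 then x = e_i - A i j * e_j satisfies x^T A x <= 0; positivity
   of the form at x - (A x)_k e_k then forces (A x)_k = 0. *)
Lemma psd_ternary_row i j k : A i j != 0 -> A i k = A i j * A j k.
Proof.
move=> ij0.
set a := A i j; set t := A i k - a * A j k.
have := Apsd.2 (delta_mx i 0 - a *: delta_mx j 0 - t *: delta_mx k 0).
have mE (u v : 'M[R]_1) : (u - v) 0 0 = u 0 0 - v 0 0 by rewrite !mxE.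
have sE c (v : 'M[R]_1) : (c *: v) 0 0 = c * v 0 0 by rewrite !mxE.
have tB (u v : 'cV[R]_n) : (u - v)^T = u^T - v^T by apply/matrixP => x y; rewrite !mxE.
have tZ c (u : 'cV[R]_n) : (c *: u)^T = c *: u^T by apply/matrixP => x y; rewrite !mxE.
rewrite !tB !tZ !(mulmxBl, mulmxBr, =^~ scalemxAl, =^~ scalemxAr).
rewrite !(mE, sE) !quad_delta.
rewrite (psd_sym j i) (psd_sym k i) (psd_sym k j) -/a.
have a1 : a * a = 1.
  have := Atern i j; rewrite -/a !inE (negPf ij0) /=.
  by case/orP => /eqP ->; rewrite ?mulrNN mulr1.
have := ternary_norm_le1 i i; have := ternary_norm_le1 j j.
have := ternary_norm_le1 k k; rewrite !ler_norml.
move=> /andP[_ k1] /andP[_ j1] /andP[_ i1] h.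
apply/eqP; rewrite -subr_eq0 -/t -sqrf_eq0 eq_le sqr_ge0 andbT expr2.
have tE : A i k = t + a * A j k by rewrite /t; ring.
rewrite tE in h.
have h1 : t * t * A k k <= t * t by rewrite ler_piMr // -expr2 sqr_ge0.
(* Since [a * a = 1] and diagonal entries are at most 1, the right-hand side is at most
   [- (t * t)]. *)
have {}h : 0 <= A i i - a * a * (2 - A j j) - 2 * (t * t) + t * t * A k k.
  by apply: le_trans h _; rewrite le_eqVlt; apply/orP; left; apply/eqP; ring.
rewrite a1 in h; lra.
Qed.

End TernaryPSD.

(** The equality disjunct gives reflexivity at zero rows, which become singleton classes. *)
Definition linked (R : realType) n (A : 'M[R]_n) : rel 'I_n :=
  [rel i j | (i == j) || (A i j != 0)].

(** Transitivity holds because [A x z = A x y * A y z] is a product of nonzero factors when [A x y]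
    and [A y z] are nonzero. *)
Lemma linked_equivalence (R : realType) n (A : 'M[R]_n) :
  ternary_mx A -> psd_mx A -> equivalence_rel (linked A).
Proof.
move=> At Ap; apply/equivalence_relP; split => [i|i j]; rewrite /linked /=.
  by rewrite eqxx.
have tr x y z : linked A x y -> linked A y z -> linked A x z.
  rewrite /linked /= => /orP[/eqP->//|xy] /orP[/eqP<-|yz]; first by rewrite xy orbT.
  by rewrite (psd_ternary_row At Ap z xy) mulf_neq0 // orbT.
have sy x y : linked A x y = linked A y x.
  by rewrite /linked /= eq_sym (psd_sym Ap).
by move=> ij k; apply/idP/idP; apply: tr; rewrite // sy.
Qed.

(** * Spectral norm bounded by row sums *)

Section Schur.
Variables (R : realType) (n : nat).

(* Schur's test, from 2 x_j x_l <= x_j^2 + x_l^2. *)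
Lemma spectral_norm_le_row_sum (A : 'M[R]_n) (d : R) :
  A \is symmetricmx -> 0 <= d -> (forall i, \sum_j `|A i j| <= d) ->
  spectral_norm A <= d.
Proof.
move=> /symmetricmxP Asym d0 Ad; apply: ge_sup; first exact: (spectral_norm_has_sup A).1.
move=> _ [x /= x1 <-].
have {}x1 : \sum_i x i 0 ^+ 2 <= 1.
  by rewrite -(ler_sqrt _ ler01) sqrtr1.
rewrite -(ger0_norm d0) -sqrtr_sqr; apply: ler_wsqrtr.
(* Cauchy-Schwarz with weights [|A i j|], after which one row sum is bounded by [d]. *)
have row_le i : (A *m x) i 0 ^+ 2 <= d * \sum_j `|A i j| * x j 0 ^+ 2.
  apply: (@le_trans _ _ ((\sum_j `|A i j|) * \sum_j `|A i j| * x j 0 ^+ 2)); last first.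
    apply: ler_wpM2r => //; apply: sumr_ge0 => j _.
    by rewrite mulr_ge0 ?sqr_ge0.
  rewrite mxE expr2 -(ler_pM2l (x := 2)) // !mulr_suml !mulr_sumr.
  have sw : \sum_j \sum_l `|A i j| * `|A i l| * x j 0 ^+ 2 =
            \sum_j \sum_l `|A i j| * `|A i l| * x l 0 ^+ 2 :> R.
    rewrite exchange_big /=; apply: eq_bigr => j _; apply: eq_bigr => l _.
    by rewrite (mulrC `|A i l|).
  have -> : \sum_j 2 * (`|A i j| * \sum_l `|A i l| * x l 0 ^+ 2) =
     \sum_j \sum_l `|A i j| * `|A i l| * (x j 0 ^+ 2 + x l 0 ^+ 2).
    under [RHS]eq_bigr => j _ do (under eq_bigr => l _ do rewrite mulrDr; rewrite big_split /=).
    rewrite big_split /= sw -mulr_sumr mulr_natl mulr2n.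
    by congr (_ + _); apply: eq_bigr => j _; rewrite mulr_sumr;
       apply: eq_bigr => l _; rewrite mulrA.
  apply: ler_sum => j _; rewrite !mulr_sumr; apply: ler_sum => l _.
  have -> : 2 * (A i j * x j 0 * (A i l * x l 0)) =
            (A i j * A i l) * (2 * (x j 0 * x l 0)) by ring.
  apply: (le_trans (ler_norm _)); rewrite normrM normrM ler_wpM2l ?mulr_ge0 //.
  by rewrite ler_norml; have := sqr_ge0 (x j 0 + x l 0);
     have := sqr_ge0 (x j 0 - x l 0) => h1 h2; apply/andP; split; nra.
apply: (@le_trans _ _ (\sum_i d * \sum_j `|A i j| * x j 0 ^+ 2)).
  exact: ler_sum.
rewrite -mulr_sumr expr2 ler_wpM2l // exchange_big /=.
apply: (@le_trans _ _ (\sum_j d * x j 0 ^+ 2)); last first.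
  by rewrite -mulr_sumr ler_piMr.
apply: ler_sum => j _; rewrite -mulr_suml ler_wpM2r ?sqr_ge0 //.
(* By symmetry the column sum is a row sum. *)
rewrite (le_trans _ (Ad j)) // le_eqVlt; apply/orP; left; apply/eqP.
by apply: eq_bigr => i _; rewrite Asym.
Qed.

End Schur.

(** * Misra-Gries counters up to an equivalence relation *)

Section MisraGries.
Variable n : nat.
Implicit Types (c : {ffun 'I_n -> nat}) (e : rel 'I_n).

Definition live c : seq 'I_n := [seq r <- enum 'I_n | (0 < c r)%N].

(** [head i m] is a live representative of the class of [i], or [i] itself if there is none, so one
    formula both increments and opens counters. *)
Definition mg_step (k : nat) e c (i : 'I_n) : {ffun 'I_n -> nat} :=
  let m := [seq r <- live c | e i r] in
  if (m != [::]) || (size (live c) < k)%N then [ffun x => c x + (x == head i m)]%N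
  else [ffun x => (c x).-1].

Lemma mem_live c r : (r \in live c) = (0 < c r)%N.
Proof. by rewrite mem_filter mem_enum andbT. Qed.

Lemma size_live c : size (live c) = (\sum_r (0 < c r)%N)%N.
Proof. by rewrite size_filter -sum1_count big_enum_cond /= big_mkcond /=; apply: eq_bigr => r _; case: ifP. Qed.

(** A step tests [i] only against live indices, so it can be run on a matrix known only at those
    entries. *)
Lemma eq_in_mg_step k e e' c i :
  {in live c, e i =1 e' i} -> mg_step k e c i = mg_step k e' c i.
Proof. by move=> ee'; rewrite /mg_step (eq_in_filter ee'). Qed.

(* d is the number of decrement rounds performed while reading s. *)
Record mg_inv (k : nat) e (s : seq 'I_n) c (d : nat) : Prop := MgInv {
  mg_size : (size (live c) <= k)%N;
  mg_distinct : forall r r', (0 < c r)%N -> (0 < c r')%N -> e r r' -> r = r';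
  mg_total : (\sum_r c r + k.+1 * d <= size s)%N;
  mg_count : forall x, exists2 r, e x r & (count (e x) s <= c r + d)%N
}.

Lemma mg_inv0 k e : reflexive e -> mg_inv k e [::] [ffun=> 0%N] 0.
Proof.
move=> er; split => [|r r'||x].
- by rewrite size_live big1 // => r _; rewrite ffunE.
- by rewrite ffunE.
- by rewrite big1 ?muln0 // => r _; rewrite ffunE.
- by exists x.
Qed.

(** A decrement lowers [k] live counters by one and drops the new item: these [k.+1] units are the
    weight of a round in [mg_total]. *)
Lemma mg_inv_step k e s c d i : equivalence_rel e -> mg_inv k e s c d ->
  exists d', mg_inv k e (rcons s i) (mg_step k e c i) d'.
Proof.
case/equivalence_relP => er el [sz ds tot cnt].
have es : symmetric e by move=> x y; apply/idP/idP => /el <-.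
have c_cat x : count (e x) (rcons s i) = (count (e x) s + e x i)%N.
  by rewrite -cats1 count_cat /= addn0.
rewrite /mg_step; set m := [seq r <- live c | e i r].
have mP r : r \in m = e i r && (0 < c r)%N by rewrite mem_filter mem_live.
set h := head i m.
(* For empty [m] the default makes [h] equal to [i], and reflexivity applies. *)
have eih : e i h.
  by rewrite /h; case E: m mP => [|r m'] /= mP; rewrite ?er //;
     move: (mP r); rewrite mem_head => /esym/andP[].
have hc : m != [::] -> (0 < c h)%N.
  by rewrite /h; case E: m mP => [|r m'] //= mP _; move: (mP r); rewrite mem_head => /esym/andP[].
have no_live : m = [::] -> forall r, e i r -> c r = 0%N.
  move=> m0 r eir; apply/eqP; rewrite -leqn0 leqNgt; apply/negP => cr.
  by have := mP r; rewrite m0 eir cr.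
have hun r : e i r -> (0 < c r)%N -> r = h.
  move=> eir cr; case: (eqVneq m [::]) => [/no_live/(_ r eir) c0|/hc ch].
    by rewrite c0 in cr.
  by apply: ds => //; rewrite -(el _ _ eir).
case: ifP => [hk|/negbT]; last first.
  rewrite negb_or negbK -leqNgt => /andP[/eqP m0 ksz].
  exists d.+1; split => [|r r'||x].
  - apply: leq_trans sz; rewrite !size_live; apply: leq_sum => r _.
    by rewrite ffunE; case: (c r) => [|[]].
  - by rewrite !ffunE => cr cr'; apply: ds; [move: cr | move: cr']; case: (c _).
  - rewrite size_rcons mulnS.
    rewrite addSn addnS ltnS addnA; apply: leq_trans tot; rewrite leq_add2r.
    rewrite size_live in ksz.
    apply: (@leq_trans (\sum_r [ffun x => (c x).-1] r + \sum_r (0 < c r)%N)%N).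
      by rewrite leq_add2l.
    rewrite -big_split /=; apply: leq_sum => r _; rewrite ffunE.
    by case: (c r) => // p; rewrite addn1.
  (* In the class of [i] the counter is already 0 and the growth of [d] pays for the new occurrence;
     elsewhere it makes up for the decrement. *)
  have [r exr hr] := cnt x; exists r => //; rewrite c_cat ffunE.
  case exi: (e x i); last by move: hr; lia.
  by rewrite (no_live m0 r) in hr *; [move: hr; lia | rewrite -(el _ _ exi)].
exists d; split => [|r r'||x].
- case: (eqVneq m [::]) hk => [m0 /= lk|/hc ch _]; last first.
    apply: leq_trans sz; rewrite !size_live; apply: leq_sum => r _.
    by rewrite ffunE; case: eqVneq => [->|]; rewrite ?addn0 // ch; case: (0 < _)%N.
  apply: leq_trans lk; rewrite !size_live (bigD1 h) //= [X in (_ <= X.+1)%N](bigD1 h) //=.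
  rewrite -[leqRHS]add1n leq_add ?leq_b1 //.
  apply: leq_trans (leq_addl _ _); apply: leq_sum => r /negPf rh.
  by rewrite ffunE rh addn0.
- have gen q : (0 < [ffun x => c x + (x == h)] q)%N -> (0 < c q)%N \/ q = h.
    by rewrite ffunE; case: eqVneq => [->|]; [right|rewrite addn0; left].
  move=> /gen[cr|->] /gen[cr'|->] err' //.
  + exact: ds.
  + by apply: hun => //; rewrite (el _ _ eih) es.
  + by apply/esym/hun => //; rewrite (el _ _ eih).
- rewrite size_rcons.
  have -> : (\sum_r [ffun x => c x + (x == h)] r = (\sum_r c r).+1)%N.
    under eq_bigr => r _ do rewrite ffunE.
    rewrite big_split /= -addn1; congr addn.
    by rewrite (bigD1 h) //= eqxx big1 ?addn0 // => r /negPf->.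
  by rewrite addSn ltnS.
have [r exr hr] := cnt x; rewrite c_cat.
case exi: (e x i); last by exists r; rewrite // ffunE; move: hr; lia.
exists h; first by rewrite (el _ _ exi).
(* If [c r] is 0, then [d] alone bounds the old count and the new unit at [h] pays for [i];
   otherwise [r] is live, hence equal to [h]. *)
rewrite ffunE eqxx; case: (posnP (c r)) => [c0|cr]; first by move: hr; lia.
have -> : h = r by apply/esym/hun => //; rewrite -(el _ _ exi).
by move: hr; lia.
Qed.

Lemma mg_inv_foldl k e s : equivalence_rel e ->
  exists d, mg_inv k e s (foldl (mg_step k e) [ffun=> 0%N] s) d.
Proof.
move=> eqe; elim/last_ind: s => [|s i [d inv]].
  by exists 0%N; apply: mg_inv0 => x; case: (eqe x x x).
by rewrite foldl_rcons; apply: mg_inv_step inv.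
Qed.

(** Without a live index, the occurrences of a class are bounded by [d] alone, and [mg_total] bounds
    [k.+1 * d]. *)
Lemma mg_missed_class k e s x : equivalence_rel e ->
  (forall r, e x r -> r \notin live (foldl (mg_step k e) [ffun=> 0%N] s)) ->
  (k.+1 * count (e x) s <= size s)%N.
Proof.
move=> /(@mg_inv_foldl k e s)[d [_ _ tot cnt]] missed.
have [r exr] := cnt x; have := missed r exr; rewrite mem_live -leqNgt leqn0 => /eqP->.
rewrite add0n => le_d; apply: leq_trans tot; apply: leq_trans (leq_addl _ _).
by rewrite leq_mul2l.
Qed.

End MisraGries.

(** * Query algorithms and their cost *)

Section Queries.
Variables (R : realType) (n : nat).
Implicit Types (A M : 'M[R]_n) (ps : seq ('I_n * 'I_n)).

Definition mask ps A : 'M[R]_n :=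
  \matrix_(i, j) if (i, j) \in ps then A i j else 0.

(* The continuation receives the entries read, in a matrix that is 0 elsewhere. *)
Fixpoint read_entries ps (k : 'M[R]_n -> query_alg R n) : query_alg R n :=
  if ps is p :: ps' then
    Query p.1 p.2 (fun v => read_entries ps' (fun M =>
      k (\matrix_(i, j) if (i, j) == p then v else M i j)))
  else k 0.

Lemma read_entriesE ps k A :
  run (read_entries ps k) A = run (k (mask ps A)) A /\
  num_reads (read_entries ps k) A = (size ps + num_reads (k (mask ps A)) A)%N.
Proof.
elim: ps k => [|p ps IH] k /=.
  by have -> : mask [::] A = 0 by apply/matrixP => i j; rewrite !mxE in_nil.
have [-> ->] := IH (fun M => k (\matrix_(i, j) if (i, j) == p then A p.1 p.2 else M i j)).
have -> // : \matrix_(i, j) (if (i, j) == p then A p.1 p.2 else mask ps A i j) =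
  mask (p :: ps) A.
by apply/matrixP => i j; rewrite !mxE in_cons; case: eqVneq => [<-|].
Qed.

Fixpoint mg_alg (k : nat) (s : seq 'I_n) (c : {ffun 'I_n -> nat})
    (cont : {ffun 'I_n -> nat} -> query_alg R n) : query_alg R n :=
  if s is i :: s' then
    read_entries [seq (i, r) | r <- live c]
      (fun M => mg_alg k s' (mg_step k (linked M) c i) cont)
  else cont c.

Lemma mg_algE k s c cont A :
  run (mg_alg k s c cont) A = run (cont (foldl (mg_step k (linked A)) c s)) A.
Proof.
elim: s c => //= i s IH c; have [-> _] := read_entriesE [seq (i, r) | r <- live c]
  (fun M => mg_alg k s (mg_step k (linked M) c i) cont) A.
rewrite IH (@eq_in_mg_step _ _ (linked (mask _ A)) (linked A)) // => r rc.
by rewrite /linked /= mxE map_f.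
Qed.

(** With [s0] the part already processed, the counters stay in the form to which the invariant
    applies, so each step reads at most [k] entries. *)
Lemma mg_alg_num_reads k s s0 cont A : equivalence_rel (linked A) ->
  let c t := foldl (mg_step k (linked A)) [ffun=> 0%N] t in
  (num_reads (mg_alg k s (c s0) cont) A <=
    k * size s + num_reads (cont (c (s0 ++ s))) A)%N.
Proof.
move=> eqA /=; pose c t := foldl (mg_step k (linked A)) [ffun=> 0%N] t.
rewrite -!/(c _); elim: s s0 => [|i s IH] s0; first by rewrite cats0 muln0.
rewrite [mg_alg _ _ _ _]/=.
have [_ ->] := read_entriesE [seq (i, r) | r <- live (c s0)]
  (fun M => mg_alg k s (mg_step k (linked M) (c s0) i) cont) A.
rewrite (@eq_in_mg_step _ _ (linked (mask _ A)) (linked A)); last first.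
  by move=> r rc; rewrite /linked /= mxE map_f.
have -> : mg_step k (linked A) (c s0) i = c (rcons s0 i) by rewrite /c foldl_rcons.
have [d [sz _ _ _]] := mg_inv_foldl k s0 eqA.
rewrite -cat_rcons /= mulnS -addnA; apply: leq_add (IH _).
by rewrite size_map.
Qed.

(** * Reconstruction from the columns read *)

Definition covered M (s : seq 'I_n) (i : 'I_n) : bool := has (fun r => M i r != 0) s.

(** For [M i r] nonzero the entry should be [M i r * M r j]; symmetry replaces [M r j] by [M j r],
    which lies in a column that is read. *)
Definition rebuild M (s : seq 'I_n) : 'M[R]_n :=
  \matrix_(i, j) if [seq r <- s | M i r != 0] is r :: _ then M i r * M j r else 0.

Definition sketch_alg (k : nat) : query_alg R n :=
  mg_alg k (enum 'I_n) [ffun=> 0%N] (fun c =>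
    read_entries [seq (i, r) | i <- enum 'I_n, r <- live c]
      (fun M => Return (rebuild M (live c)))).

Lemma rebuildE A s : ternary_mx A -> psd_mx A ->
  rebuild A s = \matrix_(i, j) if covered A s i then A i j else 0.
Proof.
move=> At Ap; apply/matrixP => i j; rewrite !mxE /covered has_filter.
case E: [seq r <- s | A i r != 0] => [//|r s'] /=.
have : r \in [seq r <- s | A i r != 0] by rewrite E mem_head.
rewrite mem_filter => /andP[ir _]; rewrite (psd_sym Ap j r).
by rewrite -(psd_ternary_row At Ap).
Qed.

Lemma rebuild_mask A s :
  rebuild (mask [seq (i, r) | i <- enum 'I_n, r <- s] A) s = rebuild A s.
Proof.
have mE i r : r \in s -> mask [seq (i, r) | i <- enum 'I_n, r <- s] A i r = A i r.
  by move=> rs; rewrite mxE allpairs_f // mem_enum.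
apply/matrixP => i j; rewrite !mxE.
rewrite (@eq_in_filter _ _ (fun r => A i r != 0)) => [|r rs]; last by rewrite mE.
case E: [seq r <- s | A i r != 0] => [//|r s'] /=.
have : r \in [seq r <- s | A i r != 0] by rewrite E mem_head.
by rewrite mem_filter => /andP[_ rs]; rewrite !mE.
Qed.

(** Row [i] is [A i j] times row [j], so both have the same support. *)
Lemma covered_linked A s i j : ternary_mx A -> psd_mx A ->
  A i j != 0 -> covered A s i = covered A s j.
Proof.
move=> At Ap ij; apply: eq_has => r.
by rewrite (psd_ternary_row At Ap r ij) mulf_eq0 (negPf ij).
Qed.

(** Let D be the diagonal 0/1 matrix of covered indices. As [covered] is constant on blocks, the
    output is D A D, and its form at x is that of A at D x. *)
Lemma rebuild_psd A s : ternary_mx A -> psd_mx A ->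
  ternary_mx (rebuild A s) /\ psd_mx (rebuild A s).
Proof.
move=> At Ap; rewrite rebuildE //.
set p := covered A s.
split; first by move=> i j; rewrite mxE; case: ifP => _ //; rewrite !inE eqxx orbT.
have pE i j : (if p i then A i j else 0) = (p i)%:R * A i j * (p j)%:R.
  case: (eqVneq (A i j) 0) => [->|ij]; first by rewrite mulr0 mul0r if_same.
  by rewrite /p (covered_linked s At Ap ij); case: covered; rewrite !(mul1r, mulr1, mul0r).
split.
  apply/symmetricmxP => i j; rewrite !mxE !pE (psd_sym Ap j i).
  ring.
move=> x; apply: (le_trans (Ap.2 (\col_i ((p i)%:R * x i 0)))).
rewrite le_eqVlt; apply/orP; left; apply/eqP; rewrite mxE [RHS]mxE.
apply: eq_bigr => j _; rewrite !mxE mulrA; congr (_ * _).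
rewrite mulr_suml; apply: eq_bigr => i _; rewrite !mxE pE; ring.
Qed.

End Queries.

(** * Reads and error of the sketch *)

Theorem theorem9 (R : realType) :
  exists2 C : R, 0 < C &
  forall (n : nat) (eps : R), 0 < eps -> eps < 1 ->
  exists alg : query_alg R n,
  forall A : 'M[R]_n, ternary_mx A -> psd_mx A ->
  [/\ (1 < n)%N -> (num_reads alg A)%:R <= C * (n%:R * ln n%:R / eps),
      ternary_mx (run alg A),
      psd_mx (run alg A) &
      spectral_norm (A - run alg A) <= eps * n%:R].
Proof.
have ln2 : 0 < ln 2 :> R by rewrite ln_gt0 // ltr1n.
(* At most [2 * (n * k)] entries are read, and [ln n / ln 2] is at least 1 once [1 < n]. *)
exists (2 / ln 2) => [|n eps eps0 eps1]; first by rewrite divr_gt0.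
(* The bound [k <= 1 / eps] controls the reads, and [1 / eps < k.+1] the error. *)
set k := Num.truncn eps^-1.
have /andP[k_le k_gt] : k%:R <= eps^-1 < k.+1%:R.
  by apply: truncn_itv; rewrite invr_ge0 ltW.
exists (sketch_alg R n k) => A At Ap.
have eqA := linked_equivalence At Ap.
set c := foldl (mg_step k (linked A)) [ffun=> 0%N] (enum 'I_n).
have runE : run (sketch_alg R n k) A = rebuild A (live c).
  by rewrite /sketch_alg mg_algE (read_entriesE _ _ _).1 /= rebuild_mask.
have [tB pB] := rebuild_psd (live c) At Ap.
rewrite runE; split => // [n1|].
  have reads : (num_reads (sketch_alg R n k) A <= 2 * (n * k))%N.
    have := mg_alg_num_reads k (enum 'I_n) [::] (fun c =>
      read_entries [seq (i, r) | i <- enum 'I_n, r <- live c]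
        (fun M => Return (rebuild M (live c)))) eqA.
    rewrite /= (read_entriesE _ _ _).2 /= addn0 size_allpairs size_enum_ord -/c.
    have [d [sz _ _ _]] := mg_inv_foldl k (enum 'I_n) eqA.
    by move=> h; apply: (leq_trans h); rewrite mul2n -addnn mulnC leq_add // leq_mul2l sz orbT.
  apply: (@le_trans _ _ (2 * (n * k))%:R); first by rewrite ler_nat.
  rewrite !natrM -[leRHS]mulrA ler_wpM2l //.
  have -> : (ln 2)^-1 * (n%:R * ln n%:R / eps) = n%:R * ((ln n%:R / ln 2) * eps^-1) :> R.
    by ring.
  rewrite ler_wpM2l // (le_trans k_le) // ler_peMl ?invr_ge0 ?(ltW eps0) //.
  by rewrite ler_pdivlMr // mul1r ler_ln ?posrE ?ltr0n ?ler_nat // (ltn_trans _ n1).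
apply: spectral_norm_le_row_sum => [||i].
- apply/symmetricmxP => i j; rewrite !mxE (psd_sym Ap j i).
  by have := psd_sym pB i j; rewrite !mxE => ->.
- by rewrite mulr_ge0 // ltW.
rewrite rebuildE //.
case: (boolP (covered A (live c) i)) => [ci|nci].
  by rewrite big1 ?mulr_ge0 ?(ltW eps0) // => j _; rewrite !mxE ci subrr normr0.
apply: (@le_trans _ _ (\sum_j (A i j != 0)%:R)).
  apply: ler_sum => j _; rewrite !mxE (negPf nci) subr0.
  by case: eqVneq => [->|_]; rewrite ?normr0 ?ternary_norm_le1.
(* If [A i i] is 0, then [i] may be live and yet uncovered; but [A i i = A i j * A j i = A i j ^+ 2]
   wherever [A i j] is nonzero, so the whole row is zero. *)
case: (eqVneq (A i i) 0) => [ii0|ii].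
  rewrite big1 ?mulr_ge0 ?(ltW eps0) // => j _.
  case: eqVneq => // ij; have := psd_ternary_row At Ap i ij.
  by rewrite ii0 (psd_sym Ap j i) => /eqP; rewrite eq_sym mulf_eq0 orbb (negPf ij).
have missed : (k.+1 * count (linked A i) (enum 'I_n) <= n)%N.
  rewrite -[leqRHS]size_enum_ord; apply: mg_missed_class => // r.
  rewrite -/c => ir; apply: contra nci => rc; apply/hasP; exists r => //.
  by move: ir => /orP[/eqP<-|].
have -> : \sum_j (A i j != 0)%:R = (count (linked A i) (enum 'I_n))%:R :> R.
  rewrite -natr_sum; congr _%:R.
  rewrite -sum1_count big_enum_cond /= [RHS]big_mkcond; apply: eq_bigr => j _.
  by rewrite /linked /=; case: (eqVneq i j) => [<-|_] /=; [rewrite ii | case: (A i j != 0)].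
(* The row sum divided by [eps] is at most [k.+1] times the class size, hence at most [n]. *)
rewrite mulrC -ler_pdivrMr // mulrC.
apply: (@le_trans _ _ (k.+1%:R * (count (linked A i) (enum 'I_n))%:R)).
  by rewrite ler_wpM2r // ltW.
by rewrite -natrM ler_nat.
Qed.
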